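(* Let $n\ge d\ge 1$ be integers and let $J\subseteq\mathbb{R}$ be an interval with nonempty interior. Suppose that for every $t\in J$, $p(x,t)$ is a polynomial in $x$ of degree $d$ with distinct positive roots $r_1(t)^2>\dots>r_d(t)^2>0$ (where $r_k(t)>0$), with coefficients differentiable in $t$, and that $p$ satisfies $$\partial_t p(x,t)=-2\left(x\,\partial_x^2+(n+1)\,\partial_x\right)p(x,t),\qquad t\in J.$$ Then for all $k=1,\dots,d$ and all $t\in J$, $$\dot r_k(t)=\sum_{j\colon j\ne k}\left(\frac{1}{r_k(t)-r_j(t)}+\frac{1}{r_k(t)+r_j(t)}\right)+\frac{n+1}{r_k(t)}.$$
   Context: A dot denotes the derivative with respect to $t$ (one-sided at endpoints of $J$ belonging to $J$). Sums over $j$ range over $j\in\{1,\dots,d\}\setminus\{k\}$. *)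

(* Defs.v *)
From mathcomp Require Import all_boot all_order all_algebra.
From mathcomp Require Import all_classical all_reals all_analysis.
Set Implicit Arguments.
Unset Strict Implicit.
Unset Printing Implicit Defensive.
Import Order.TTheory GRing.Theory Num.Theory.
Import numFieldNormedType.Exports.
Local Open Scope classical_set_scope.
Local Open Scope ring_scope.

(* The difference quotient is restricted to s in J with s <> t: this is the
   usual derivative at interior points of J and the one-sided derivative at an
   endpoint.  The limit l is unique only when t is an accumulation point of J,
   which holds for every t in an interval J with nonempty interior. *)
Definition is_derive_in (R : realType) (J : set R) (f : R -> R) (t l : R) :
  Prop :=
  (f s - f t) / (s - t) @[s --> within J t^'] --> l.

(* Main.v *)
Require Import Defs.
From mathcomp Require Import all_boot all_order all_algebra.
From mathcomp Require Import all_classical all_reals all_analysis.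
From mathcomp Require Import ring lra.
Set Implicit Arguments.
Unset Strict Implicit.
Unset Printing Implicit Defensive.
Import Order.TTheory GRing.Theory Num.Theory.
Import numFieldNormedType.Exports.
Local Open Scope classical_set_scope.
Local Open Scope ring_scope.

(** Write [a_i = r_i ^ 2] for the roots of [p] and [c] for its leading
    coefficient, so that [p(x, s) = c(s) \prod_i (x - a_i(s))].

    The proof evaluates [p] at time [s] at the fixed point [x = a_k(t)], where
    [p(., t)] vanishes:
    [p(a_k(t), s) = - (a_k(s) - a_k(t)) Q(s)], with
    [Q(s) = c(s) \prod_(i != k) (a_k(t) - a_i(s))].
    Dividing by [s - t] and letting [s] tend to [t] inside [J], the left-hand
    side converges to the value prescribed by the equation, namely
    [-2 (a_k p'' + (n + 1) p')] at [a_k(t)], while [Q(s)] converges to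
    [Q(t) = p'(a_k(t)) <> 0].  So [a_k] is differentiable, without any recourse
    to the implicit function theorem, and its derivative is
    [2 a_k p''/p' + 2 (n + 1)].  At a simple root
    [p''/p' = 2 \sum_(j != k) (a_k - a_j)^-1]
    ([horner_deriv_at_root], [horner_deriv2_at_root]); dividing by [2 r_k] and
    splitting [2 r_k / (r_k ^ 2 - r_j ^ 2)] into partial fractions gives the
    claim.

    The convergence of [Q(s)] requires the continuity of every root [a_i]
    ([cvg_ordered_roots]).  As [p(a_k(t), s)] tends to [0] and [c(s)] to
    [c(t) <> 0], the product [\prod_i (a_k(t) - a_i(s))] tends to [0], so some
    root at time [s] is close to [a_k(t)]; since the roots are listed in
    decreasing order at both times, this root must be [a_k(s)]. *)

Lemma ord_homo_ltn_id (d : nat) (f : 'I_d -> 'I_d) :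
  {homo f : i j / (i < j)%N} -> f =1 id.
Proof.
have ge_id (g : 'I_d -> 'I_d) (i : 'I_d) :
    {homo g : i j / (i < j)%N} -> (i <= g i)%N.
  move=> g_homo; case: i => m; elim: m => [//|m IHm] lt_m.
  apply: leq_ltn_trans (IHm (ltnW lt_m)) _; exact: g_homo.
move=> f_homo i; apply/val_inj/eqP; rewrite eqn_leq (ge_id f i f_homo) andbT.
(* Conjugation by [rev_ord] turns the lower bound [i <= g i] into an upper one. *)
have /(_ (rev_ord i)) := ge_id (fun j => rev_ord (f (rev_ord j))).
rewrite rev_ordK /= leq_sub2lE ?ltn_ord //; apply=> j k lt_jk /=.
rewrite ltn_sub2lE ?ltn_ord // ltnS; apply: f_homo.
by rewrite /= ltn_sub2lE ?ltn_ord.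
Qed.

Lemma poly_factor_distinct_roots (K : fieldType) (d : nat) (p : {poly K})
    (a : 'I_d -> K) :
  size p = d.+1 -> injective a -> (forall i, root p (a i)) ->
  p = p`_d *: \prod_(i < d) ('X - (a i)%:P).
Proof.
move=> size_p a_inj root_a.
rewrite {1}(@all_roots_prod_XsubC _ p [seq a i | i <- enum 'I_d]).
- by rewrite lead_coefE size_p big_map big_enum.
- by rewrite size_map size_enum_ord.
- by apply/allP => _ /mapP[i _ ->].
- by rewrite uniq_rootsE map_inj_uniq // enum_uniq.
Qed.

(** Logarithmic derivative of a split polynomial, away from its roots. *)
Lemma horner_deriv_prod_XsubC (K : fieldType) (I : Type) (s : seq I)
    (P : pred I) (a : I -> K) (x : K) :
  (forall i, P i -> x != a i) ->
  (\prod_(i <- s | P i) ('X - (a i)%:P))^`().[x] =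
  \prod_(i <- s | P i) (x - a i) * \sum_(i <- s | P i) (x - a i)^-1.
Proof.
move=> x_neq; elim: s => [|i s IHs]; first by rewrite !big_nil derivC horner0 mulr0.
rewrite !big_cons; case: ifP => // Pi.
rewrite derivM hornerD !hornerM derivXsubC hornerC mul1r IHs horner_prod hornerXsubC.
under eq_bigr do rewrite hornerXsubC.
have := x_neq i Pi; rewrite -subr_eq0 => xi0; field.
exact: xi0.
Qed.

Lemma horner_deriv_at_root (K : comNzRingType) (d : nat) (a : 'I_d -> K)
    (c : K) (k : 'I_d) :
  (c *: \prod_(i < d) ('X - (a i)%:P))^`().[a k] =
  c * \prod_(i < d | i != k) (a k - a i).
Proof.
rewrite (bigD1 k) //= derivZ derivM derivXsubC !hornerE subrr mul0r addr0.
by rewrite horner_prod; under eq_bigr do rewrite hornerXsubC.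
Qed.

(** If [p = (X - a_k) q], then [p''(a_k) = 2 q'(a_k)], and the logarithmic
    derivative of [q] at [a_k] is the sum over the other roots. *)
Lemma horner_deriv2_at_root (K : fieldType) (d : nat) (a : 'I_d -> K)
    (c : K) (k : 'I_d) : injective a ->
  (c *: \prod_(i < d) ('X - (a i)%:P))^`(2).[a k] =
  2 * (c * \prod_(i < d | i != k) (a k - a i))
    * \sum_(i < d | i != k) (a k - a i)^-1.
Proof.
move=> a_inj; rewrite (bigD1 k) //=.
set q := \prod_(i < d | _) _.
have -> : (c *: (('X - (a k)%:P) * q))^`()^`() =
    c *: (q^`() *+ 2 + ('X - (a k)%:P) * q^`()^`()).
  rewrite !derivZ derivM derivXsubC mul1r derivD derivM derivXsubC mul1r.
  by rewrite addrA -mulr2n.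
rewrite hornerZ hornerD hornerMn hornerM hornerXsubC subrr mul0r addr0.
rewrite horner_deriv_prod_XsubC; last first.
  by move=> i; apply: contraNneq => /a_inj ->.
by ring.
Qed.

Lemma prodr_norm_lt_expn (R : realFieldType) (d : nat) (x : 'I_d -> R) (e : R) :
  0 < e -> \prod_(i < d) `|x i| < e ^+ d -> exists i, `|x i| < e.
Proof.
move=> e0 lt_prod; apply/existsP; apply: contraTT lt_prod.
rewrite negb_exists -leNgt => /forallP far.
rewrite -[in leLHS](card_ord d) -prodr_const; apply: ler_prod => i _.
by rewrite ltW //= leNgt far.
Qed.

(** Continuity of simple real roots, stated without polynomials.  Let [e] be
    smaller than half of every gap between the [b]'s.  When the products are
    below [e ^+ d], each [b_l] has some [a_(f l)] within [e]; these
    neighbourhoods are disjoint and ordered, so [f] is strictly increasing,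
    hence the identity. *)
Lemma cvg_ordered_roots (R : realType) (T : Type) (F : set_system T)
    (FF : Filter F) (d : nat) (a : T -> 'I_d -> R) (b : 'I_d -> R) :
  (\forall s \near F, forall i j : 'I_d, (i < j)%N -> a s j < a s i) ->
  (forall i j : 'I_d, (i < j)%N -> b j < b i) ->
  (forall k, \prod_(i < d) (b k - a s i) @[s --> F] --> 0) ->
  forall k, a s k @[s --> F] --> b k.
Proof.
move=> a_dec b_dec prod0 k; apply/cvgrPdist_lt => e0 e0_gt0.
have [e [e_gt0 e_lt e_gap]] : exists e : R, [/\ 0 < e, e < e0 &
    forall ij : 'I_d * 'I_d, (ij.1 < ij.2)%N -> 2 * e < b ij.1 - b ij.2].
  have gap : \forall e \near 0^'+, forall ij : 'I_d * 'I_d,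
      (ij.1 < ij.2)%N -> 2 * e < b ij.1 - b ij.2.
    apply: filter_forall => -[i j] /=.
    have [ij|] := boolP (i < j)%N; last by move=> _; apply: nearW.
    have gt0 : 0 < (b i - b j) / 2 by have := b_dec _ _ ij; lra.
    near=> e => _; have : e < (b i - b j) / 2 by near: e; exact: nbhs_right_lt.
    by lra.
  near ((0 : R)^'+) => e; exists e; split; last by near: e.
  - by near: e; exact: nbhs_right_gt.
  - by near: e; exact: nbhs_right_lt.
have small : \forall s \near F, forall l, \prod_(i < d) `|b l - a s i| < e ^+ d.
  apply: filter_forall => l.
  have /cvgr0Pnorm_lt/(_ _ (exprn_gt0 d e_gt0)) := prod0 l.
  by apply: filterS => s; rewrite normr_prod.
near=> s.
have a_dec_s : forall i j : 'I_d, (i < j)%N -> a s j < a s i by near: s.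
have small_s : forall l, \prod_(i < d) `|b l - a s i| < e ^+ d by near: s.
have [f f_near] := choice (fun l => prodr_norm_lt_expn e_gt0 (small_s l)).
have f_homo : {homo f : i j / (i < j)%N}.
  move=> i j ij; rewrite ltnNge; apply/negP => le_f.
  have le_a : a s (f i) <= a s (f j).
    move: le_f; rewrite leq_eqVlt => /orP[/eqP/val_inj -> //|/a_dec_s/ltW //].
  have := e_gap (i, j) ij; have := f_near i; have := f_near j.
  by rewrite !ltr_norml /= => /andP[? ?] /andP[? ?]; lra.
by rewrite -[X in a s X](ord_homo_ltn_id f_homo); apply: lt_trans (f_near k) _.
Unshelve. all: by end_near. Qed.

Lemma near_within_dnbhs_neq (R : realType) (J : set R) (t : R) :
  \forall s \near within J t^', s != t.
Proof. by apply: filterS (nbhs_dnbhs_neq t) => s. Qed.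

Lemma is_derive_in_cvg (R : realType) (J : set R) (f : R -> R) (t l : R) :
  is_derive_in J f t l -> f s @[s --> within J t^'] --> f t.
Proof.
move=> df.
have FF : Filter (within J t^') by exact: within_filter.
have st : (s - t) @[s --> within J t^'] --> 0.
  have : s - t @[s --> t] --> t - t by apply: cvgB; [exact: cvg_id|exact: cvg_cst].
  rewrite subrr; apply: cvg_trans.
  apply: cvg_app; apply: cvg_trans (@cvg_within _ _ _ _) _.
  exact: nbhs_dnbhs.
have : (f s - f t) / (s - t) * (s - t) + f t @[s --> within J t^'] -->
    l * 0 + f t by apply: cvgD; [exact: cvgM df st | exact: cvg_cst].
rewrite mulr0 add0r.
apply: cvg_trans; apply: near_eq_cvg; near=> s.
have sneq : s != t by near: s; exact: near_within_dnbhs_neq.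
have : s - t != 0 by rewrite subr_eq0.
by move=> st0 /=; rewrite divfK // subrK.
Unshelve. all: by end_near. Qed.

Theorem theorem2p7 (R : realType) (n d : nat) (J : set R)
    (p : R -> {poly R}) (r : 'I_d -> R -> R) :
  (1 <= d)%N -> (d <= n)%N ->
  is_interval J -> J° !=set0 ->
  (forall t, J t -> size (p t) = d.+1) ->
  (forall t, J t -> forall k : 'I_d, 0 < r k t) ->
  (forall t, J t -> forall i j : 'I_d, (i < j)%N -> r j t ^+ 2 < r i t ^+ 2) ->
  (forall t, J t -> forall k : 'I_d, root (p t) (r k t ^+ 2)) ->
  (forall t, J t -> forall i : nat,
     exists l : R, is_derive_in J (fun s => (p s)`_i) t l) ->
  (forall t, J t -> forall x : R,
     is_derive_in J (fun s => (p s).[x]) t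
       (- 2 * (x * (p t)^`(2).[x] + n.+1%:R * (p t)^`().[x]))) ->
  forall (k : 'I_d) (t : R), J t ->
    is_derive_in J (r k) t
      (\sum_(j < d | j != k)
          ((r k t - r j t)^-1 + (r k t + r j t)^-1)
       + n.+1%:R / r k t).
Proof.
move=> _ _ _ _ size_p r_gt0 r_dec p_root p_coef p_pde k t Jt.
have FF : Filter (within J t^') by exact: within_filter.
pose a s (i : 'I_d) := r i s ^+ 2.
have a_inj s : J s -> injective (a s).
  move=> Js i j aij; apply/val_inj.
  have [ij|ij|//] := ltngtP i j.
  - by have := r_dec s Js _ _ ij; rewrite -/(a s i) -/(a s j) aij ltxx.
  - by have := r_dec s Js _ _ ij; rewrite -/(a s i) -/(a s j) aij ltxx.
have p_factor s : J s -> p s = (p s)`_d *: \prod_(i < d) ('X - (a s i)%:P).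
  move=> Js; apply: poly_factor_distinct_roots; first exact: size_p.
  - exact: a_inj.
  - exact: p_root.
have horner_p s x : J s -> (p s).[x] = (p s)`_d * \prod_(i < d) (x - a s i).
  move=> Js; rewrite {1}p_factor // hornerZ horner_prod.
  by under eq_bigr do rewrite hornerXsubC.
have lead_neq0 s : J s -> (p s)`_d != 0.
  move=> Js; have := size_p s Js => sz.
  have -> : (p s)`_d = lead_coef (p s) by rewrite lead_coefE sz.
  by rewrite lead_coef_eq0 -size_poly_eq0 sz.
have near_J : \forall s \near within J t^', J s by exact: withinT.
have near_neq : \forall s \near within J t^', s != t by exact: near_within_dnbhs_neq.
have lead_cvg : (p s)`_d @[s --> within J t^'] --> (p t)`_d.
  by have [l] := p_coef t Jt d; exact: is_derive_in_cvg.
(* The product of the [a t l - a s i] over [i] is [p(a_l(t), s) / c(s)], and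
   the numerator tends to [p(a_l(t), t) = 0]. *)
have a_cvg : forall i, a s i @[s --> within J t^'] --> a t i.
  apply: cvg_ordered_roots.
  - by apply: filterS near_J => s Js; exact: r_dec.
  - exact: r_dec.
  move=> l; have : (p s).[a t l] / (p s)`_d @[s --> within J t^'] -->
      (p t).[a t l] / (p t)`_d.
    apply: cvgM; first exact: is_derive_in_cvg (p_pde t Jt (a t l)).
    exact: cvgV (lead_neq0 t Jt) lead_cvg.
  rewrite (rootP (p_root t Jt l)) mul0r; apply: cvg_trans.
  apply: near_eq_cvg; apply: filterS near_J => s Js /=.
  by rewrite horner_p // mulrAC mulfV ?mul1r // lead_neq0.
have r_cvg : r k s @[s --> within J t^'] --> r k t.
  have : Num.sqrt (a s k) @[s --> within J t^'] --> Num.sqrt (a t k).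
    by apply: continuous_cvg; [exact: sqrt_continuous | exact: a_cvg].
  rewrite sqrtr_sqr gtr0_norm ?r_gt0 //; apply: cvg_trans.
  apply: near_eq_cvg; apply: filterS near_J => s Js /=.
  by rewrite sqrtr_sqr gtr0_norm ?r_gt0.
pose Q s := (p s)`_d * \prod_(i < d | i != k) (a t k - a s i).
have Q_cvg : Q s @[s --> within J t^'] --> Q t.
  apply: cvgM => //; apply: cvg_big => [|i _]; first exact: mul_continuous.
  by apply: cvgB; [exact: cvg_cst|exact: a_cvg].
have Qt0 : Q t != 0.
  rewrite mulf_neq0 ?lead_neq0 //; apply/prodf_neq0 => i ik.
  by rewrite subr_eq0; apply: contraNneq ik => /(a_inj t Jt) ->.
have rr_cvg : (r k s + r k t) @[s --> within J t^'] --> r k t + r k t.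
  by apply: cvgD => //; exact: cvg_cst.
have rt0 := r_gt0 t Jt k.
have near_Q : \forall s \near within J t^', Q s != 0.
  exact: cvgr_neq0 (Q t) Q_cvg Qt0.
(* [r k s - r k t] is [a s k - a t k] divided by [r k s + r k t]; the minus
   sign comes from [p(a_k(t), s) = - (a s k - a t k) * Q s]. *)
have : - (((p s).[a t k] - (p t).[a t k]) / (s - t) / Q s / (r k s + r k t))
    @[s --> within J t^'] -->
    - (- 2 * (a t k * (p t)^`(2).[a t k] + n.+1%:R * (p t)^`().[a t k])
       / Q t / (r k t + r k t)).
  apply: cvgN; apply: cvgM; last exact: cvgV (lt0r_neq0 (addr_gt0 rt0 rt0)) rr_cvg.
  apply: cvgM; [exact: p_pde | exact: cvgV Qt0 Q_cvg].
have -> : (p t)^`().[a t k] = Q t by rewrite {1}p_factor // horner_deriv_at_root.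
have -> : (p t)^`(2).[a t k] =
    2 * Q t * \sum_(j < d | j != k) (a t k - a t j)^-1.
  by rewrite {1}p_factor // horner_deriv2_at_root //; exact: a_inj.
have sumE : \sum_(j < d | j != k) ((r k t - r j t)^-1 + (r k t + r j t)^-1) =
    2 * r k t * \sum_(j < d | j != k) (a t k - a t j)^-1.
  rewrite big_distrr /=; apply: eq_bigr => j jk.
  have : a t k - a t j != 0.
    by rewrite subr_eq0; apply: contraNneq jk => /(a_inj t Jt) ->.
  rewrite /a subr_sqr mulf_eq0 negb_or => /andP[? ?]; field.
  by apply/andP; split.
rewrite /is_derive_in sumE; set S := \sum_(j < d | _) _.
have -> : - (- 2 * (a t k * (2 * Q t * S) + n.+1%:R * Q t)
             / Q t / (r k t + r k t)) = 2 * r k t * S + n.+1%:R / r k t.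
  by rewrite /a; field; rewrite Qt0 !lt0r_neq0 ?addr_gt0.
apply: cvg_trans; apply: near_eq_cvg; near=> s.
have Js : J s by near: s.
have st : s - t != 0 by rewrite subr_eq0; near: s.
have Qs0 : Q s != 0 by near: s.
have rs0 := r_gt0 s Js k.
have rr0 : r k s + r k t != 0 by rewrite lt0r_neq0 // addr_gt0.
rewrite /= (rootP (p_root t Jt k)) horner_p // (bigD1 k) //=.
rewrite mulrCA -/(Q s) /a; field.
by rewrite Qs0 st rr0.
Unshelve. all: by end_near. Qed.
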